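(* Let $G$ be a connected graph. (a) If $G$ is claw-free and bull-free, then $C(G)\le 2$. (b) If $G$ is claw-free, net-free and antenna-free, then $C(G)\le 3$. (c) If $G$ is claw-free and net-free, then $C(G)\le 5$.
   Context: All graphs are finite, simple and undirected. ''$H$-free'' means having no induced subgraph isomorphic to $H$. The claw is $K_{1,3}$. The bull is a triangle $abc$ together with two further vertices $d,e$, where $d$ is adjacent only to $a$ and $e$ is adjacent only to $b$. The net is a triangle with one pendant vertex attached to each of its three vertices. The antenna is the 6-vertex graph obtained from the house, which is a 4-cycle $p_1p_2p_3p_4$ plus a vertex $p_5$ adjacent exactly to $p_1$ and $p_2$, by adding a vertex $p_6$ adjacent only to $p_5$. $C(G)$ is the cop number in the standard game: cops are placed first, then the robber; afterwards cops and robber alternate moves, each moving along an edge or staying put; capture means a cop occupies the robber's vertex. *)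

(* Defs.v *)
From HB Require Import structures.
From mathcomp Require Import all_boot.
From mathcomp Require Import boolp.

Set Implicit Arguments.
Unset Strict Implicit.
Unset Printing Implicit Defensive.

Record sgraph := SGraph {
  vertex :> finType;
  adj : rel vertex;
  adj_sym : symmetric adj;
  adj_irrefl : irreflexive adj }.

Arguments adj {s} x y : rename.

(* The graph with no vertices is not considered connected. *)
Definition connected_graph (G : sgraph) : Prop :=
  0 < #|G| /\ forall x y : G, connect adj x y.

Definition graph_iso (G H : sgraph) : Prop :=
  exists2 f : G -> H, bijective f & {mono f : x y / adj x y}.

Section Induced.
Variables (G : sgraph) (S : {set G}).

Definition induced_adj : rel {x : G | x \in S} := relpre val adj.

Lemma induced_adj_sym : symmetric induced_adj.
Proof. by move=> x y; apply: adj_sym. Qed.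

Lemma induced_adj_irrefl : irreflexive induced_adj.
Proof. by move=> x; apply: adj_irrefl. Qed.

Definition induced := SGraph induced_adj_sym induced_adj_irrefl.
End Induced.

Definition graph_free (H G : sgraph) : Prop :=
  ~ exists S : {set G}, graph_iso (induced S) H.

Section EdgeList.
Variables (n : nat) (E : seq (nat * nat)).

Definition edges_adj : rel 'I_n :=
  fun i j => (i != j) &&
    (((val i, val j) \in E) || ((val j, val i) \in E)).

Lemma edges_adj_sym : symmetric edges_adj.
Proof. by move=> i j; rewrite /edges_adj eq_sym orbC. Qed.

Lemma edges_adj_irrefl : irreflexive edges_adj.
Proof. by move=> i; rewrite /edges_adj eqxx. Qed.

Definition edges_graph := SGraph edges_adj_sym edges_adj_irrefl.
End EdgeList.

Definition claw : sgraph := edges_graph 4 [:: (0, 1); (0, 2); (0, 3)].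

(* triangle 0 1 2, with 3 attached to 0 and 4 attached to 1 *)
Definition bull : sgraph :=
  edges_graph 5 [:: (0, 1); (1, 2); (2, 0); (3, 0); (4, 1)].

(* triangle 0 1 2, with 3, 4, 5 attached to 0, 1, 2 respectively *)
Definition net : sgraph :=
  edges_graph 6 [:: (0, 1); (1, 2); (2, 0); (3, 0); (4, 1); (5, 2)].

(* 4-cycle 0 1 2 3, roof 4 adjacent to 0 and 1, and 5 attached to 4 *)
Definition antenna : sgraph :=
  edges_graph 6
    [:: (0, 1); (1, 2); (2, 3); (3, 0); (4, 0); (4, 1); (5, 4)].

Section CopsAndRobber.
Variable G : sgraph.

Definition legal_move (x y : G) : bool := (x == y) || adj x y.

(* A strategy s for k cops gives the cops' positions as a function of the
   robber's positions so far: s [::] is the initial placement, chosen before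
   the robber's, and s [:: r_0; ...; r_n] is the cops' answer when the robber
   has just reached r_n. *)
Definition cop_strategy (k : nat) (s : seq G -> 'I_k -> G) : Prop :=
  forall (h : seq G) (x : G) (i : 'I_k), legal_move (s h i) (s (rcons h x) i).

Definition robber_play (r : nat -> G) : Prop :=
  forall n, legal_move (r n) (r n.+1).

(* The robber at r n is captured either on arriving at r n, where a cop already
   stands, or by the cops' next move. *)
Definition captured (k : nat) (s : seq G -> 'I_k -> G) (r : nat -> G) : Prop :=
  exists n (i : 'I_k), s (mkseq r n) i = r n \/ s (mkseq r n.+1) i = r n.

Definition cops_win (k : nat) : Prop :=
  exists2 s : seq G -> 'I_k -> G,
    cop_strategy s & forall r, robber_play r -> captured s r.

Lemma cops_win_card : cops_win #|G|.
Proof.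
exists (fun _ i => enum_val i) => [h x i|r _]; first by rewrite /legal_move eqxx.
by exists 0, (enum_rank (r 0)); left; rewrite enum_rankK.
Qed.

Lemma cops_win_exists : exists k, `[< cops_win k >].
Proof. by exists #|G|; apply/asboolP/cops_win_card. Qed.

Definition cop_number : nat := ex_minn cops_win_exists.
End CopsAndRobber.

(* Main.v *)
(** One cop X never moves, while g chasers (g = 1 or 2) occupy consecutive
vertices of an induced path T ending at the robber and follow him along T.
Whenever the robber moves, either he is captured, or he becomes adjacent to a
vertex between the chasers and himself, and T can be shortened there, or T
grows, or he closes an induced cycle with at least g + 3 vertices.  In a
connected (claw, net)-free graph every induced cycle with at least 5 vertices is
dominating, and so is every induced 4-cycle if there is no antenna either.  So
X is equal or adjacent to a vertex of the cycle; such a vertex cannot have been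
visited by the robber, hence it is in the initial part of T, which shrinks when
T is cut down to the cycle.  Thus 3 cops win in (claw, net)-free graphs and 2
cops win in (claw, net, antenna)-free graphs; the net and the antenna both
contain an induced bull. *)
Require Import Defs.
From mathcomp Require Import all_boot.
From mathcomp Require Import boolp zify.

Set Implicit Arguments.
Unset Strict Implicit.
Unset Printing Implicit Defensive.

(** * Induced subgraphs as embeddings *)

Section Embedding.

Definition embeds (H G : sgraph) : Prop :=
  exists2 f : H -> G, injective f & {mono f : x y / adj x y}.

Lemma embeds_trans (G H K : sgraph) : embeds H G -> embeds K H -> embeds K G.
Proof.
move=> [f fI fM] [h hI hM]; exists (f \o h); first exact: inj_comp.
by move=> x y /=; rewrite fM hM.
Qed.

Lemma graph_freeP (H G : sgraph) : graph_free H G <-> ~ embeds H G.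
Proof.
split=> noH; [move=> [f fI fM]|move=> [S [f fB fM]]]; apply: noH.
  exists [set f x | x in [set: H]].
  have ex (y : {y | y \in [set f x | x in [set: H]]}) : exists x, f x == val y.
    by case: y => y /= /imsetP[x _ ->]; exists x.
  have gK y : f (xchoose (ex y)) = val y by apply/eqP/(xchooseP (ex y)).
  exists (fun y => xchoose (ex y)); last by move=> x y; rewrite -fM !gK.
  have mf x : f x \in [set f x | x in [set: H]] by apply: imset_f.
  exists (fun x => exist _ (f x) (mf x)) => x.
    by apply: val_inj; rewrite /= gK.
  by apply: fI; rewrite gK.
have [h fK hK] := fB.
exists (val \o h); first exact: inj_comp val_inj (can_inj hK).
by move=> x y; rewrite -[in RHS](hK x) -[in RHS](hK y) fM.
Qed.

Lemma bull_net : embeds bull net.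
Proof.
exists (widen_ord (leqnSn 5)); first by move=> i j [] /val_inj.
by move=> [[|[|[|[|[|i]]]]] Hi] [[|[|[|[|[|j]]]]] Hj].
Qed.

Lemma bull_antenna : embeds bull antenna.
Proof.
(* The triangle is the roof 4, 0, 1 of the antenna; its pendants are 5 at 4 and 3 at 0, and vertex 2
   is left out. *)
exists (fun i : bull => @inord 5 (nth 0 [:: 4; 0; 1; 5; 3] (i : 'I_5))).
  move=> [[|[|[|[|[|i]]]]] Hi] [[|[|[|[|[|j]]]]] Hj] //= /(congr1 val);
  by rewrite /= !inordK // => // _; apply: val_inj.
by move=> [[|[|[|[|[|i]]]]] Hi] [[|[|[|[|[|j]]]]] Hj] //=;
  rewrite /edges_adj -val_eqE /= !inordK.
Qed.

End Embedding.

(** * Equality or adjacency, and embeddings from vertex lists *)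

Section Game.
Variable G : sgraph.
Implicit Types (x y z r : G) (s : seq G).

Local Notation dom := (@legal_move G).
Local Arguments legal_move : simpl never.

Lemma domC x y : dom x y = dom y x.
Proof. by rewrite /legal_move eq_sym adj_sym. Qed.

Lemma domxx x : dom x x.
Proof. by rewrite /legal_move eqxx. Qed.

Lemma dom_eqF x y : ~~ dom x y -> (x == y = false) * (adj x y = false).
Proof. by rewrite negb_or => /andP[/negbTE-> /negbTE->]. Qed.

(** Non-edges are required as [~~ dom], which excludes equality too, so that injectivity comes with
    the adjacency conditions; by symmetry pairs [i < j] suffice. *)
Lemma embeds_edges (x0 : G) (n : nat) (E : seq (nat * nat)) (s : seq G) :
  size s = n ->
  (forall i j : nat, i < j -> j < n ->
     if ((i, j) \in E) || ((j, i) \in E) then adj (nth x0 s i) (nth x0 s j)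
     else ~~ dom (nth x0 s i) (nth x0 s j)) ->
  embeds (edges_graph n E) G.
Proof.
move=> sz sE.
have sN i j : i < j -> j < n -> nth x0 s i != nth x0 s j.
  move=> ij jn; move: (sE i j ij jn); case: ifP => _.
    by apply: contraTneq => ->; rewrite adj_irrefl.
  by move=> /dom_eqF ->.
exists (fun i : edges_graph n E => nth x0 s (i : 'I_n)) => i j.
  case: (ltngtP (i : 'I_n) (j : 'I_n)) => [ij|ji|/val_inj] // eqij.
    by have := sN _ _ ij (ltn_ord _); rewrite eqij eqxx.
  by have := sN _ _ ji (ltn_ord _); rewrite eqij eqxx.
rewrite -[RHS]/(edges_adj E i j) /edges_adj -val_eqE.
case: (ltngtP (i : 'I_n) (j : 'I_n)) => /= [ij|ji|/val_inj->].
- by have := sE _ _ ij (ltn_ord _); case: ifP => // _ /dom_eqF->.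
- rewrite orbC adj_sym.
  by have := sE _ _ ji (ltn_ord _); case: ifP => // _ /dom_eqF->.
- by rewrite adj_irrefl.
Qed.

(** * From positions won in bounded time to strategies *)

(* Positions with the cops to move, the robber having just arrived at [r]; the
   cops can capture within [n.+1] moves. *)
Fixpoint forced k n (c : 'I_k -> G) r : Prop :=
  exists2 c', forall i, dom (c i) (c' i) &
    (exists i, c' i = r) \/
    (if n is n'.+1 then forall r', dom r r' -> forced n' c' r' else False).

Lemma forced_capture k n (c : 'I_k -> G) r i : dom (c i) r -> forced n c r.
Proof.
move=> ci.
have E : exists2 c', forall i, dom (c i) (c' i) & exists i, c' i = r.
  exists (fun i => if dom (c i) r then r else c i); last first.
    by exists i; rewrite ci.
  by move=> j; case: ifP => //; rewrite domxx.
by case: E => c' c'L c'r; case: n => [|n]; exists c' => //; left.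
Qed.

(** Choice gives a reply [σ] depending only on the moves left, the cops and the robber; the strategy
    folds [σ] along the history, counting the moves down. *)
Lemma forced_win k n (c0 : 'I_k -> G) :
  (forall r, forced n c0 r) -> cops_win G k.
Proof.
move=> c0W.
have [σ σL σW] : exists2 σ : nat -> ('I_k -> G) -> G -> 'I_k -> G,
    forall n c r i, dom (c i) (σ n c r i) &
    forall n c r, forced n c r -> (exists i, σ n c r i = r) \/
    (if n is n'.+1 then forall r', dom r r' -> forced n' (σ n c r) r' else False).
  have /choice[σ σP] : forall a : nat * ('I_k -> G) * G, exists c',
      (forall i, dom (a.1.2 i) (c' i)) /\
      (forced a.1.1 a.1.2 a.2 -> (exists i, c' i = a.2) \/
      (if a.1.1 is n'.+1 then forall r', dom a.2 r' -> forced n' c' r' else False)).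
    move=> [[m c] r] /=; have [F|F] := pselect (forced m c r).
      by case: m F => [|m] [c' L R]; exists c'.
    (* Outside winning positions the cops stay put, so that [σ] is always legal. *)
    by exists c; split => // i; apply: domxx.
  by exists (fun m c r => σ (m, c, r)) => m c r; case: (σP (m, c, r)).
pose st := fix st m c h := if h is x :: h' then st m.-1 (σ m c x) h' else c.
exists (st n c0) => [h x i|r rL].
  elim: h n c0 {c0W} => [|y h IH] m c /=; [exact: σL|exact: IH].
suff [m [i E]] : exists m i, st n c0 (mkseq r m.+1) i = r m.
  by exists m, i; right.
elim: n c0 r rL {c0W} (c0W (r 0)) => [|n IH] c r rL /σW[[i E]|] //;
  try by exists 0, i.
move=> /(_ _ (rL 0))/(IH _ (r \o succn)) [p|m [i E]]; first exact: rL.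
exists m.+1, i; rewrite -[RHS]E /mkseq -[iota _ _]/(0 :: iota 1 m.+1).
by rewrite -(addn0 1) iotaDl map_cons -map_comp.
Qed.

(** * Induced paths *)

Fixpoint ipath s : bool :=
  match s with
  | x :: s' =>
    match s' with
    | y :: s'' => [&& adj x y, ~~ has (dom x) s'' & ipath s']
    | [::] => true
    end
  | [::] => true
  end.

Lemma ipath_cons2 x y s :
  ipath [:: x, y & s] = [&& adj x y, ~~ has (dom x) s & ipath (y :: s)].
Proof. by []. Qed.

Lemma ipath_behead x s : ipath (x :: s) -> ipath s.
Proof. by case: s => [|y s] // /and3P[]. Qed.

Lemma ipath_drop s1 s2 : ipath (s1 ++ s2) -> ipath s2.
Proof. by elim: s1 => //= x s1 IH /ipath_behead. Qed.

Lemma ipath_take s1 s2 : ipath (s1 ++ s2) -> ipath s1.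
Proof.
elim: s1 => [|x [|y s1] IH] //=; rewrite has_cat negb_or.
by move=> /and3P[-> /andP[-> _] /IH].
Qed.

Lemma ipath_uniq s : ipath s -> uniq s.
Proof.
elim: s => [|x [|y s] IH] //; rewrite ipath_cons2 => /and3P[xy xs /IH us].
rewrite cons_uniq us andbT inE negb_or; apply/andP; split.
  by apply: contraTneq xy => ->; rewrite adj_irrefl.
by apply: contra xs => xs; apply/hasP; exists x; rewrite ?domxx.
Qed.

Lemma ipath_path x s : ipath (x :: s) -> path adj x s.
Proof. by elim: s x => [|y s IH] x //= /and3P[-> _ /IH]. Qed.

Lemma ipath_rcons2 s y x :
  ipath (rcons (rcons s y) x) =
  [&& adj y x, ~~ has (dom x) s & ipath (rcons s y)].
Proof.
elim: s => [|a [|b s] IH]; first by rewrite /= !andbT.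
  by rewrite /= !andbT !orbF (domC x a) andbC -andbA [RHS]andbCA.
rewrite !rcons_cons !ipath_cons2 -!rcons_cons IH.
rewrite /= !has_rcons !(negb_or (dom _ _)) (domC x a).
by case: (adj y x); case: (dom a x); case: (adj a b); rewrite ?andbF //= andbCA.
Qed.

(** Attach [x] to the last vertex of [s1] that it dominates and drop everything before. That vertex
    is not [x] itself, since its successor would then be dominated. *)
Lemma shortcut x s1 s2 : ipath (s1 ++ s2) -> s2 != [::] ->
  ~~ has (dom x) s2 -> has (dom x) s1 ->
  exists s, [/\ s != [::], size s <= size s1 & ipath (x :: s ++ s2)].
Proof.
move=> + s2N xs2; elim: s1 => [|y s1 IH] // P.
rewrite [has _ _]/=; case xs1 : (has (dom x) s1); last rewrite orbF.
  have [s [? ? ?]] := IH (ipath_behead P) xs1.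
  by exists s; split => //=; apply: leqW.
move=> xy; exists (y :: s1); split=> //.
have N : ~~ has (dom x) (s1 ++ s2) by rewrite has_cat xs1.
rewrite cat_cons ipath_cons2 N -cat_cons P !andbT.
have /orP[/eqP E|//] := xy; subst y.
move: P N; rewrite cat_cons; case: (s1 ++ s2) (size_cat s1 s2) => [|w t _].
  by case: (s2) s2N => //= *; lia.
by rewrite ipath_cons2 => /and3P[xw _ _]; rewrite /= /legal_move xw orbT.
Qed.

Lemma connect_ipath x y : connect adj x y ->
  exists2 s, ipath (x :: s) & last x s = y.
Proof.
case/connectP=> p; elim: p x => [|z p IH] x; first by exists [::].
move=> /= /andP[xz /IH] H /H[s Ps Ls].
have {xz}: has (dom x) (z :: s) by rewrite /= /legal_move xz orbT.
elim: s z Ps Ls {H} => [|w s IHs] z Ps Ls.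
  rewrite /= orbF => /orP[/eqP->|xz]; first by exists [::].
  by exists [:: z] => //=; rewrite xz.
case xws : (has (dom x) (w :: s)).
  by move=> _; apply: IHs xws => //; apply: ipath_behead Ps.
rewrite -[has _ _]/(dom x z || has (dom x) (w :: s)) xws orbF => /orP[/eqP->|xz].
  by exists (w :: s).
by exists [:: z, w & s] => //; rewrite ipath_cons2 xz xws.
Qed.

(** * Induced cycles and their rotations *)

(* [x, y, s, z] lists, in cyclic order, the vertices of an induced cycle. *)
Definition icycle x y s z : bool :=
  [&& ipath (y :: rcons s z), adj x y, adj x z & ~~ has (dom x) s].

Lemma icycle_rot x y y' s z :
  icycle x y (y' :: s) z -> icycle y y' (rcons s z) x.
Proof.
rewrite /icycle rcons_cons ipath_cons2.
move=> /and4P[/and3P[yy' yN P] xy xz xN].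
rewrite -!rcons_cons ipath_rcons2 rcons_cons P (adj_sym z) xz xN yy'.
by rewrite adj_sym xy.
Qed.

Lemma icycle_rotr x y y' s z :
  icycle y y' (rcons s z) x -> icycle x y (y' :: s) z.
Proof.
rewrite /icycle -!rcons_cons ipath_rcons2 !rcons_cons ipath_cons2.
move=> /and4P[/and3P[zx xN P] yy' yx yN].
by rewrite P xN yN yy' adj_sym yx adj_sym zx.
Qed.

Lemma icycle_rot_to c x y s z : 0 < size s -> icycle x y s z ->
  c \in [:: x, y & rcons s z] ->
  exists y' s' z', [/\ icycle c y' s' z', size s' = size s &
    [:: c, y' & rcons s' z'] =i [:: x, y & rcons s z]].
Proof.
move En: (index c [:: x, y & rcons s z]) => n; elim: n x y s z En => [|n IH] x y.
  by move=> s z /=; case: eqP => // -> _ _ C _; exists y, s, z.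
case=> [|y' s] z //; rewrite [index _ _]/=; case: eqP => // /eqP xc [En] _ C.
rewrite in_cons eq_sym (negbTE xc) orFb => cs.
have cL : [:: y, y' & rcons (rcons s z) x] =i [:: x, y, y' & rcons s z].
  by move=> d; rewrite -!rcons_cons mem_rcons.
have [||||b [t [e [C' tE tL]]]] := IH y y' (rcons s z) x.
- by rewrite -[rcons (rcons s z) x]cats1 -!cat_cons index_cat cs.
- by rewrite size_rcons.
- exact: icycle_rot.
- by rewrite cL in_cons cs orbT.
exists b, t, e; split=> //; first by rewrite tE size_rcons.
by move=> d; rewrite tL cL.
Qed.

(** * Induced cycles are dominating *)

Section Domination.
Hypothesis (clawF : graph_free claw G) (netF : graph_free net G).

Lemma claw_absurd a b c d : adj a b -> adj a c -> adj a d ->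
  ~~ dom b c -> ~~ dom b d -> ~~ dom c d -> False.
Proof.
move=> ab ac ad bc bd cd; apply: (proj1 (graph_freeP _ _) clawF).
apply: (@embeds_edges a _ _ [:: a; b; c; d]) => //.
by move=> [|[|[|[|i]]]] [|[|[|[|j]]]].
Qed.

Lemma net_absurd a b c a' b' c' :
  adj a b -> adj a c -> adj b c -> adj a a' -> adj b b' -> adj c c' ->
  ~~ dom a b' -> ~~ dom a c' -> ~~ dom b a' -> ~~ dom b c' ->
  ~~ dom c a' -> ~~ dom c b' -> ~~ dom a' b' -> ~~ dom a' c' -> ~~ dom b' c' ->
  False.
Proof.
move=> *; apply: (proj1 (graph_freeP _ _) netF).
apply: (@embeds_edges a _ _ [:: a; b; c; a'; b'; c']) => //.
by move=> [|[|[|[|[|[|i]]]]]] [|[|[|[|[|[|j]]]]]].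
Qed.

Lemma dom_eqN u w c : adj u w -> ~~ dom w c -> ~~ adj u c -> ~~ dom u c.
Proof.
move=> uw wc uc; rewrite negb_or uc andbT.
by apply: contraNneq wc => <-; rewrite domC /legal_move uw orbT.
Qed.

(** Suppose [w] dominates no cycle vertex. Then [u] misses [y'] and [z], or it would centre a claw.
    The triangle [u x y] with pendants [w], [z], [y'] is a net, unless [y'] and [z] are adjacent;
    then the cycle has length 4 and forms an antenna with [u] and [w]. *)
Lemma icycle_attach_edge x y y' s z u w :
  0 < size s \/ graph_free antenna G -> icycle x y (y' :: s) z ->
  adj u x -> adj u y -> adj u w ->
  has (dom w) [:: x, y, y' & rcons s z].
Proof.
move=> long /and4P[P xy xz xN] ux uy uw; apply/negPn/negP.
move: P; rewrite rcons_cons ipath_cons2 => /and3P[yy' yN P].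
rewrite /= has_rcons !(negb_or (dom _ _)) => /and5P[wx wy wy' wz _].
move: yN; rewrite has_rcons (negb_or (dom _ _)) => /andP[yz _].
move: xN; rewrite /= (negb_or (dom _ _)) => /andP[xy' _].
have uy' : ~~ dom u y'.
  by apply: (dom_eqN uw wy'); apply/negP => uy'; apply: (claw_absurd uw ux uy').
have uz : ~~ dom u z.
  by apply: (dom_eqN uw wz); apply/negP => uz; apply: (claw_absurd uw uy uz).
have [y'z|] := boolP (dom y' z); last first.
  by rewrite domC => zy'; apply: (net_absurd ux uy xy uw xz yy') => //; rewrite domC.
case: long => [|antF].
  case: s P => [|b s] // + _; rewrite rcons_cons ipath_cons2 has_rcons.
  by rewrite (negb_or (dom _ _)) y'z andbF.
apply: (proj1 (graph_freeP _ _) antF).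
have {}y'z : adj y' z.
  case/orP: y'z => // /eqP E; move: xz xy'.
  by rewrite -E /legal_move => ->; rewrite orbT.
apply: (@embeds_edges x _ _ [:: x; y; y'; z; u; w]) => //.
by move=> [|[|[|[|[|[|i]]]]]] [|[|[|[|[|[|j]]]]]] //= _ _;
  rewrite 1?adj_sym // domC.
Qed.

(** If [u] misses both cycle neighbours of [x], these and [u] form a claw at [x]; otherwise [u] is
    adjacent to both ends of a cycle edge. *)
Lemma icycle_attach x y s z u w :
  0 < size s -> 1 < size s \/ graph_free antenna G -> icycle x y s z ->
  adj u x -> adj u w -> has (dom w) [:: x, y & rcons s z].
Proof.
move=> s_gt0 long C ux uw; apply/negPn/negP => N.
have /and4P[P xy xz xN] := C.
move: (N); rewrite /= has_rcons !(negb_or (dom _ _)) => /and4P[wx wy wz _].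
have ? : ~~ dom y z.
  case: (s) P s_gt0 => // a s' + _; rewrite rcons_cons ipath_cons2 has_rcons.
  by rewrite (negb_or (dom _ _)) => /and3P[_ /andP[]].
have [uy|uyN] := boolP (adj u y).
  case: s {P xN} s_gt0 long C N => [|y' s] // _ long C.
  by rewrite (icycle_attach_edge long C ux uy uw).
have [uz|uzN] := boolP (adj u z); last first.
  apply: (claw_absurd xy xz (_ : adj x u)) => //; rewrite 1?adj_sym //.
    by rewrite domC; apply: dom_eqN uw _ _.
  by rewrite domC; apply: dom_eqN uw _ _.
(* Rotate backwards so that the edge [z x] comes first. *)
case/lastP: s {P xN} s_gt0 long C N => [|s t] // _.
rewrite size_rcons => long /icycle_rotr C /negP; apply.
have := icycle_attach_edge long C uz ux uw.
rewrite /= !has_rcons.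
by case: (dom w x); case: (dom w y); case: (dom w z).
Qed.

Hypothesis Gconn : connected_graph G.

(** Being dominated by the cycle passes to neighbours, hence along a walk from [x] to [v]. *)
Lemma icycle_dominates x y s z v :
  0 < size s -> 1 < size s \/ graph_free antenna G -> icycle x y s z ->
  has (dom v) [:: x, y & rcons s z].
Proof.
move=> s_gt0 long C; set L := [:: x, y & rcons s z].
have /connectP[p + ->] := Gconn.2 x v.
have : has (dom x) L by rewrite /= domxx.
elim: p {1 2 3}x => [|w p IH] u //= uL /andP[uw]; apply: IH.
have [c cL uc] := hasP (uL : has (dom u) L).
case/orP: uc => [/eqP uc|uc].
  by apply/hasP; exists c; rewrite // -uc domC /legal_move uw orbT.
have [b [t [e [C' tE tL]]]] := icycle_rot_to s_gt0 C cL.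
rewrite -tE in s_gt0 long; have := icycle_attach s_gt0 long C' uc uw.
by rewrite (eq_has_r tL).
Qed.

End Domination.

(** * The chase along an induced path *)

Section Chase.
Variables (g : nat) (X : G).
Hypothesis dominating : forall x y s z v, g <= size s -> icycle x y s z ->
  has (dom v) [:: x, y & rcons s z].

(** Cop 0 is the motionless one on [X]; cop [i.+1] is the chaser on entry [i] of [F]. *)
Definition cops_at (F : seq G) (i : 'I_g.+1) : G := nth X (X :: F) i.

Lemma cops_at_step F F' : size F = size F' ->
  (forall i, i < g -> dom (nth X F i) (nth X F' i)) ->
  forall i, dom (cops_at F i) (cops_at F' i).
Proof. by move=> sF FF' [[|i] iP]; rewrite /cops_at /= ?domxx //; apply: FF'. Qed.

Let K := #|G|.+1.

(** A lexicographic order in base [K]: the gap [size P] to the chasers, then the part of [T] not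
    known to avoid [X], then [K - size T], which falls as [T] grows. *)
Let measure (P T : seq G) (b : nat) :=
  size P * (K * K) + (size T - b) * K + (K - size T).

Lemma measure_lt P T b P' T' b' :
  0 < b' -> 0 < size T' < K ->
  [|| size P' < size P,
      (size P' == size P) && (size T' - b' < size T - b) |
      [&& size P' == size P, size T' - b' == size T - b & size T < size T']] ->
  measure P' T' b' < measure P T b.
Proof.
rewrite /measure; set x := _ - b; set x' := _ - b'.
move=> b'0 /andP[T'0 T'K]; have x'K : x' < K by rewrite /x'; lia.
move: (size T) (size T') (size P) (size P') x x' T'0 T'K x'K.
move=> t t' p p' x x' t'0 t'K x'K /or3P[pp|/andP[/eqP-> xx]|/and3P[/eqP-> /eqP->]].
- have : p' * (K * K) + K * K <= p * (K * K) by rewrite addnC -mulSn leq_mul2r pp orbT.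
  have : x' * K + K <= K * K by rewrite addnC -mulSn leq_mul2r x'K orbT.
  lia.
- have : x' * K + K <= x * K by rewrite addnC -mulSn leq_mul2r xx orbT.
  lia.
- lia.
Qed.

Lemma ipath_size s : ipath s -> size s < K.
Proof. by move=> /ipath_uniq/card_uniqP <-; rewrite ltnS max_card. Qed.

(* [T] is read from the robber backwards, [F] being the chasers' vertices, and
   its first [b] vertices are at distance at least 2 from [X]; when [T] is cut
   down to an induced cycle, [size T - b] decreases. *)
Lemma chase N P F S b (T := P ++ F ++ S) : 0 < g -> size F = g -> P != [::] ->
  ipath T -> b <= size T -> ~~ has (dom X) (take b T) -> measure P T b <= N ->
  forall r, dom (head X P) r -> forced N (cops_at F) r.
Proof.
move=> g_gt0 sF; elim: N P F S b @T sF => [|N IH] P F S b T sF PN TP bT bX; subst T.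
  by case: P PN {TP bT bX} => // r P _; rewrite /measure /K; clear; lia.
move=> mN r' rr'.
have [Xr'|Xr'] := boolP (dom X r').
  by apply: (@forced_capture _ _ _ _ ord0).
have [/(has_nthP X)[i iF Fr']|Fr'] := boolP (has (dom r') F).
  rewrite sF -ltnS in iF; apply: (@forced_capture _ _ _ _ (Ordinal iF)).
  by rewrite domC.
(* Each chaser moves one vertex along the new path: the last vertex of [P2] joins [F] and the last
   one of [F] passes to the tail. *)
have advance P2 S2 b2 (T2 := r' :: P2 ++ F ++ S2) : P2 != [::] -> ipath T2 ->
    b2 <= size T2 -> ~~ has (dom X) (take b2 T2) -> measure P2 T2 b2 <= N ->
    forced N.+1 (cops_at F) r'.
  move=> P2N; rewrite {}/T2; case/lastP: P2 P2N => [|P3 y] // _.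
  case/lastP: F sF {TP bT bX mN Fr'} => [|F1 z] sF; first by rewrite -sF in g_gt0.
  have <- : (r' :: P3) ++ (y :: F1) ++ (z :: S2) =
            r' :: rcons P3 y ++ rcons F1 z ++ S2 by rewrite /= !cat_rcons.
  move=> T2P b2T b2X mN; exists (cops_at (y :: F1)).
    apply: cops_at_step => [|i ig]; first by rewrite size_rcons.
    have := ipath_drop T2P.
    rewrite /= -cat_rcons => /(@ipath_take (y :: rcons F1 z)) /ipath_path.
    move=> /(pathP X)/(_ i); rewrite size_rcons -(size_rcons F1 z) sF => /(_ ig).
    rewrite domC /legal_move => ad; apply/orP; right.
    suff <- : nth X (y :: rcons F1 z) i = nth X (y :: F1) i by [].
    by rewrite -rcons_cons nth_rcons; move: ig; rewrite -sF size_rcons /= => ->.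
  right=> r'' r'r''; apply: (IH (r' :: P3) _ (z :: S2) b2) => //.
    by rewrite -sF size_rcons.
  by move: mN; rewrite /measure size_rcons.
case: P PN TP bT bX mN rr' => [|r P] // _ TP bT bX mN rr'.
have FN : F != [::] by rewrite -size_eq0 sF -lt0n.
have [Pr'|Pr'] := boolP (has (dom r') P).
  have PF : ipath (P ++ F).
    by move: TP; rewrite cat_cons => /ipath_behead; rewrite catA => /ipath_take.
  have [P2 [P2N P2P P2I]] := shortcut PF FN Fr' Pr'.
  apply: (advance P2 [::] 1); rewrite ?cats0 //.
    by rewrite /= take0 /= orbF.
  rewrite -ltnS; apply: leq_trans mN; apply: measure_lt => //.
    exact: ipath_size P2I.
  by rewrite /= ltnS P2P.
(* A robber staying at [r] would dominate the next vertex of the path, which lies in [P ++ F]. *)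
have rr'A : adj r' r.
  rewrite adj_sym; case/orP: rr' => //= /eqP E; subst r'.
  have : has (dom r) (P ++ F).
    case: P F FN TP {Pr' Fr' sF advance mN bT bX} => [|y P] [|z F] // _.
      by rewrite /= /legal_move => /and3P[-> _ _]; rewrite orbT.
    by rewrite /= /legal_move => /and3P[-> _ _]; rewrite orbT.
  by rewrite has_cat (negbTE Pr') (negbTE Fr').
have cons_ipath S' S'' : S = S' ++ S'' -> ~~ has (dom r') S' ->
    ipath (r' :: (r :: P) ++ F ++ S').
  move=> SE S'N; have: ipath ((r :: P) ++ F ++ S').
    by move: TP; rewrite SE !catA => /ipath_take.
  rewrite !cat_cons ipath_cons2 rr'A => ->.
  by rewrite !has_cat (negbTE Pr') (negbTE Fr') (negbTE S'N).
(* If [r'] dominates nothing behind the chasers either, [T] and [b] both grow by one and only the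
   last digit falls. *)
have [Sr'|Sr'] := boolP (has (dom r') S); last first.
  have TP' := cons_ipath S [::] (esym (cats0 S)) Sr'.
  apply: (advance (r :: P) S b.+1) => //; first by rewrite /= negb_or Xr'.
  rewrite -ltnS; apply: leq_trans mN; apply: measure_lt => //.
    exact: ipath_size TP'.
  by rewrite /= !subSS eqxx; apply/or3P/Or33; rewrite eqxx ltnSn.
case: {Sr'}(split_find Sr') cons_ipath TP bT bX mN => z S1 S2 r'z S1r' ci TP bT bX mN.
rewrite cat_rcons in ci TP bT bX mN.
have TP' := ci S1 _ (erefl _) S1r'.
have r'N : ~~ has (dom r') (P ++ F ++ S1).
  by rewrite !has_cat (negbTE Pr') (negbTE Fr') (negbTE S1r').
have TE : (r :: P) ++ F ++ S1 ++ z :: S2 = rcons (r :: P ++ F ++ S1) z ++ S2.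
  by rewrite cat_rcons /= -!catA.
rewrite TE in TP bT bX mN; have cP := ipath_take TP.
(* With [z] the first vertex of [S] dominated by [r'], the cycle closes; [r' = z] is impossible, as
   the vertex before [z] would be dominated earlier. *)
have C : icycle r' r (P ++ F ++ S1) z.
  rewrite /icycle rr'A r'N -rcons_cons cP /= andbT.
  case/orP: r'z => // /eqP E; subst z.
  case/lastP: (P ++ F ++ S1) cP r'N (size_cat P (F ++ S1)) => [|U u].
    by move=> _ _ /esym/eqP; rewrite size_cat sF !addn_eq0 (gtn_eqF g_gt0) andbF.
  rewrite -rcons_cons ipath_rcons2 has_rcons /legal_move (adj_sym r').
  by move=> /andP[-> _]; rewrite orbT.
have /(dominating X)/(_ C) XC : g <= size (P ++ F ++ S1).
  by rewrite !size_cat sF addnCA leq_addr.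
(* Here [z] is beyond the first [b] vertices, so cutting [T] before [z] lowers the second digit. *)
have [bz|bz] := leqP b (size (r :: P ++ F ++ S1)).
  apply: (advance (r :: P) S1 b.+1) => //.
    by rewrite /= negb_or Xr' /=; move: bX; rewrite -cats1 -catA takel_cat.
  rewrite -ltnS; apply: leq_trans mN; apply: measure_lt => //.
    exact: ipath_size TP'.
  apply/or3P/Or32; rewrite eqxx /= !size_cat /= size_rcons.
  by move: bz; rewrite /= !size_cat; clear; lia.
(* Otherwise the first [b] vertices contain the whole cycle except [r'], so [X] dominates none of
   it. *)
exfalso; move: bX; rewrite take_cat size_rcons ltnNge bz has_cat negb_or.
by move: XC; rewrite -rcons_cons [has _ _]/= (negbTE Xr') /= => ->.
Qed.

(** All cops start on [X]. In one move the chasers can occupy the last [g] vertices of an induced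
    path from the robber to [X], which are [X] and, if [g = 2], its neighbour [y]. *)
Lemma chase_wins : (forall x y : G, connect adj x y) -> 0 < g <= 2 ->
  cops_win G g.+1.
Proof.
move=> Gcon /andP[g_gt0 g_le2].
(* The horizon is a bound on the initial measure, plus one for the opening move. *)
apply: (@forced_win _ (K * (K * K) + K * K + K).+1 (cops_at (nseq g X))) => r.
have [Xr|Xr] := boolP (dom X r); first exact: (@forced_capture _ _ _ _ ord0).
have [s sP sX] := connect_ipath (Gcon r X).
case/lastP: s sP sX => [|s X'] sP; first by move=> /= E; rewrite E domxx in Xr.
rewrite last_rcons => E; subst X'.
case/lastP: s sP => [|s y] sP.
  by move: sP Xr; rewrite /= domC /legal_move => /andP[-> _]; rewrite orbT.
have yX : dom X y.
  move: sP; rewrite -!rcons_cons ipath_rcons2 domC /legal_move => /and3P[-> _ _].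
  by rewrite orbT.
have [P [F [PF rP sF FX]]] : exists P F, [/\ r :: rcons (rcons s y) X = P ++ F,
    ohead P = Some r, size F = g & forall i, i < g -> dom X (nth X F i)].
  have [->|->] : g = 1 \/ g = 2 by lia.
    exists (r :: rcons s y), [:: X]; split=> //; first by rewrite cats1.
    by case=> // _; rewrite domxx.
  exists (r :: s), [:: y; X]; split=> //; first by rewrite -cats1 cat_rcons.
  by case=> [|[]] //= _; rewrite domxx.
exists (cops_at F).
  apply: cops_at_step => [|i ig]; rewrite ?size_nseq //.
  by rewrite nth_nseq ig; apply: FX.
right=> r' rr'; case: P rP PF => [|a P] // [->] PF; rewrite PF in sP.
have sK := ipath_size sP.
apply: (@chase _ (r :: P) F [::] 1); rewrite ?cats0 //.
  by rewrite /= take0 /= orbF.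
have sPK : size (r :: P) <= K by move: sK; rewrite size_cat; lia.
rewrite /measure !leq_add ?leq_mul ?leq_subr //.
exact: leq_trans (leq_subr _ _) (ltnW sK).
Qed.

End Chase.

(** * Bounds on the cop number *)

Lemma cop_number_le k : cops_win G k -> cop_number G <= k.
Proof.
by rewrite /cop_number => Wk; case: ex_minnP => m _; apply; apply/asboolP.
Qed.

Lemma claw_net_free_cop_number : connected_graph G ->
  graph_free claw G -> graph_free net G -> cop_number G <= 3.
Proof.
move=> Gconn clawF netF; have [/card_gt0P[X _] Gcon] := Gconn.
apply/cop_number_le/(@chase_wins 2 X) => // x y s z v s_ge2.
by apply: icycle_dominates => //; [apply: ltnW|left].
Qed.

Lemma claw_net_antenna_free_cop_number : connected_graph G ->
  graph_free claw G -> graph_free net G -> graph_free antenna G ->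
  cop_number G <= 2.
Proof.
move=> Gconn clawF netF antF; have [/card_gt0P[X _] Gcon] := Gconn.
apply/cop_number_le/(@chase_wins 1 X) => // x y s z v s_ge1.
by apply: icycle_dominates => //; right.
Qed.

Lemma embeds_free H H' : embeds H H' -> graph_free H G -> graph_free H' G.
Proof.
move=> HH' /graph_freeP HG; apply/graph_freeP => H'G.
exact: HG (embeds_trans H'G HH').
Qed.
End Game.

Theorem theorem5 (G : sgraph) (Gconn : connected_graph G) :
  (graph_free claw G -> graph_free bull G -> cop_number G <= 2) /\
  (graph_free claw G -> graph_free net G -> graph_free antenna G ->
     cop_number G <= 3) /\
  (graph_free claw G -> graph_free net G -> cop_number G <= 5).
Proof.
split=> [clawF bullF|].
  apply: claw_net_antenna_free_cop_number => //.
    exact: embeds_free bull_net bullF.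
  exact: embeds_free bull_antenna bullF.
split=> [clawF netF _|clawF netF].
  exact: claw_net_free_cop_number.
exact: leq_trans (claw_net_free_cop_number Gconn clawF netF) _.
Qed.
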